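(* Let $A$ be a countable chain and let $m, n \ge 1$ be integers. If $m \le n$ then $T(m, A) \le T(n, A)$.
   Context: A chain is a strictly linearly ordered set. An integer $n \ge 1$ is identified with the chain $0<1<\dots<n-1$, and $\mathrm{Emb}(n, C)$ is the set of all order embeddings of $n$ into a chain $C$. $T(n, C)$ is the least integer $t \ge 1$ such that for every integer $k \ge 2$ and every coloring $\chi : \mathrm{Emb}(n, C) \to \{0,\dots,k-1\}$ there is a $U \subseteq C$ order-isomorphic to $C$ with $|\chi(\mathrm{Emb}(n, U))| \le t$; if no such $t$ exists, $T(n, C) = \infty$. The symbol $\infty$ is taken to be larger than every integer.
   Formalization: The chain A is assumed to be countably infinite; for finite chains the claim fails: if A has two elements then T(1, A) = 2 while T(3, A) = 1, since Emb(3, A) is empty. *)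

(* Defs.v *)
From mathcomp Require Import all_boot all_order all_algebra.
From mathcomp Require Import boolp classical_sets functions cardinality.
From mathcomp Require Import constructive_ereal.

Set Implicit Arguments.
Unset Strict Implicit.
Unset Printing Implicit Defensive.

Local Open Scope classical_set_scope.
Local Open Scope order_scope.

Section BigRamsey.
Context {d : Order.disp_t} (A : orderType d).

(* As a chain, n is 'I_n with its canonical order. *)
Definition Emb (n : nat) : Type :=
  {f : 'I_n -> A | {mono f : i j / i < j}}.

(* Emb(n, U) for U `<=` A, viewed as a subset of Emb(n, A). *)
Definition Emb_in (n : nat) (U : set A) : set (Emb n) :=
  [set f : Emb n | forall i, U (sval f i)].
Arguments Emb_in n U : clear implicits.

Definition isomorphic_copy (U : set A) : Prop :=
  exists2 g : A -> A, {mono g : x y / x < y} & set_bij [set: A] U g.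

Definition ramsey_bound (n t : nat) : Prop :=
  (1 <= t)%N /\
  forall (k : nat) (chi : Emb n -> 'I_k), (2 <= k)%N ->
    exists2 U : set A, isomorphic_copy U & (chi @` Emb_in n U #<= `I_t)%card.

(* T(n, A), valued in the integers extended by infinity. *)
Definition T (n : nat) : \bar int :=
  if pselect (exists t, `[< ramsey_bound n t >]) is left ex_t
  then ((ex_minn ex_t)%:Z%R)%:E%E else +oo%E.

End BigRamsey.

(* Main.v *)
(** Fix the set [R] of those [x] that have finitely many elements above them and
    such that every self-embedding of [A] fixes [x] and all elements above it.
    [R] is finite, since otherwise it has order type omega^* and moving each of
    its elements to its predecessor is a self-embedding that moves the maximum.
    Every self-embedding maps the complement [L] to itself, and either [L] has no
    maximum or some self-embedding lowers that maximum.  In both cases every copy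
    [U] of [A] contains a copy [U'] each of whose finite subsets lies, as far
    as [L] is concerned, strictly below some element of [U] in [L].  So every
    [m]-tuple of [U'] arises from an [m+1]-tuple of [U] by deleting the largest
    entry in [L]; pulling a coloring back along this deletion shows that a bound
    for [m+1] is a bound for [m]. *)

Require Import Defs.
From mathcomp Require Import all_boot all_order all_algebra.
From mathcomp Require Import boolp classical_sets functions cardinality.
From mathcomp Require Import constructive_ereal.

Set Implicit Arguments.
Unset Strict Implicit.
Unset Printing Implicit Defensive.

Import Order.TTheory.
Local Open Scope classical_set_scope.
Local Open Scope order_scope.

Section Chain.
Context {d : Order.disp_t} {A : orderType d}.

Lemma finite_set_max (F : set A) : finite_set F -> F !=set0 ->
  exists2 x, F x & forall y, F y -> y <= x.
Proof.
move=> /finite_seqP[[|a s] ->] [x0 //] _; elim: s a {x0} => [|b s IHs] a.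
  by exists a => [|y]; rewrite /= ?mem_head // inE => /eqP ->.
have [x xs xmax] := IHs b.
have [ax|/ltW xa] := leP a x.
  exists x => [|y]; rewrite /= inE; first by apply/orP; right.
  by move=> /orP[/eqP -> //|/xmax].
exists a => [|y]; rewrite /= ?mem_head // inE => /orP[/eqP -> //|/xmax yx].
exact: le_trans xa.
Qed.

Lemma lt_mono_inj (g : A -> A) : {mono g : x y / x < y} -> injective g.
Proof. by move=> gm; apply: inc_inj; apply: le_mono => x y; rewrite gm. Qed.

Lemma isomorphic_copy_range (g : A -> A) :
  {mono g : x y / x < y} -> isomorphic_copy (range g).
Proof.
move=> gm; exists g => //; apply: inj_bij => x y _ _.
exact: lt_mono_inj.
Qed.

Definition rigid_top : set A :=
  [set x | finite_set [set y | x <= y] /\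
    forall g : A -> A, {mono g : y z / y < z} -> forall y, x <= y -> g y = y].

Lemma rigid_top_up x y : rigid_top x -> x <= y -> rigid_top y.
Proof.
move=> [fin fixg] xy; split.
  by apply: sub_finite_set fin => z /=; apply: le_trans.
by move=> g gm z yz; apply: fixg => //; apply: le_trans yz.
Qed.

(** If [g x] were in [rigid_top], then [g] would fix it, and injectivity would give [g x = x]. *)
Lemma rigid_top_embedding (g : A -> A) x : {mono g : y z / y < z} ->
  ~ rigid_top x -> ~ rigid_top (g x).
Proof.
move=> gm xR gxR; apply: xR.
by rewrite -(lt_mono_inj gm (gxR.2 g gm _ (lexx _))).
Qed.

(** Only finitely many elements are at or above [x], so an infinite [rigid_top] has some [y < x].
    The interval from [y] up to [x] is then finite, and its largest element below [x] is the
    predecessor. *)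
Lemma rigid_top_pred x : infinite_set rigid_top -> rigid_top x ->
  exists y, [/\ rigid_top y, y < x & forall z, z < x -> z <= y].
Proof.
move=> infR xR.
have [y yR yx] : exists2 y, rigid_top y & y < x.
  apply: contrapT => noy; apply: infR; apply: sub_finite_set xR.1 => y yR /=.
  by rewrite leNgt; apply/negP => yx; apply: noy; exists y.
have [||p [yp px] pmax] := @finite_set_max [set z | y <= z /\ z < x].
- by apply: sub_finite_set yR.1 => z [].
- by exists y => /=.
exists p; split=> //; first exact: rigid_top_up yp.
move=> z zx; have [yz|/ltW zy] := leP y z; first exact: pmax.
exact: le_trans yp.
Qed.

Lemma finite_rigid_top : finite_set rigid_top.
Proof.
apply: contrapT => infR.
have predE x : exists y, rigid_top x ->
    [/\ rigid_top y, y < x & forall z, z < x -> z <= y].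
  have [/(rigid_top_pred infR)[y yP]|xR] := pselect (rigid_top x).
    by exists y.
  by exists x.
have [p pP] := choice predE.
pose h x := if `[< rigid_top x >] then p x else x.
have hm : {mono h : x y / x < y}.
  apply: leW_mono; apply: le_mono => x y xy; rewrite /h.
  case: asboolP => xR; case: asboolP => yR //.
  - have [_ pxx _] := pP _ xR; have [_ _ /(_ _ xy)] := pP _ yR.
    exact: lt_le_trans.
  - by case: yR; apply: rigid_top_up (ltW xy).
  (* Only [x] stays in place here. It is at most the predecessor of [y], and equality would put [x]
     in [rigid_top]. *)
  - have [pyR _ /(_ _ xy)] := pP _ yR.
    rewrite le_eqVlt => /orP[/eqP xE|//].
    by rewrite xE in xR.
have [R0|/set0P[x xR]] := eqVneq rigid_top set0.
  by apply: infR; rewrite R0.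
have := xR.2 h hm _ (lexx x); rewrite /h asboolT// => pxE.
by have [_] := pP _ xR; rewrite pxE ltxx.
Qed.

(** The embedding [h] is chosen before [g], so a single [h] shrinks every copy [range g] to one
    whose finite subsets are dominated, outside [rigid_top], by a point of [range g]. *)
Lemma copy_extension : infinite_set [set: A] ->
  exists2 h : A -> A, {mono h : x y / x < y} &
  forall g : A -> A, {mono g : x y / x < y} ->
  forall F, finite_set F -> F `<=` range (g \o h) ->
  exists w, [/\ range g w, ~ rigid_top w &
    forall y, F y -> ~ rigid_top y -> y < w].
Proof.
move=> infA.
have [x0 x0L] : exists x, ~ rigid_top x.
  apply: contrapT => allR; apply: infA.
  apply: sub_finite_set finite_rigid_top => x _.
  by apply: contrapT => xR; apply: allR; exists x.
have [[b [bL bmax]]|nomax] :=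
  pselect (exists b, ~ rigid_top b /\ forall y, ~ rigid_top y -> y <= b).
- have finb : finite_set [set y | b <= y].
    apply: (@sub_finite_set _ _ (b |` rigid_top)); last first.
      by rewrite finite_setU; split; [|exact: finite_rigid_top].
    move=> y /=; rewrite le_eqVlt => /orP[/eqP ->|by_]; first by left.
    right; apply: contrapT => /bmax; by rewrite leNgt by_.
  (* Everything strictly above [b] is in [rigid_top], hence fixed, and [finb] holds; so [b] can fail
     to be in [rigid_top] only by being moved itself. *)
  have [h hm hb] : exists2 h : A -> A, {mono h : x y / x < y} & h b <> b.
    apply: contrapT => noh; apply: bL; split=> // g gm y.
    rewrite le_eqVlt => /orP[/eqP <-|by_].
      by apply: contrapT => gb; apply: noh; exists g.
    have yR : rigid_top y.
      by apply: contrapT => /bmax; rewrite leNgt by_.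
    exact: yR.2.
  have hbb : h b < b.
    by rewrite lt_neqAle bmax ?andbT; [apply/eqP|apply: rigid_top_embedding].
  (* A point [g (h z)] outside [rigid_top] has [z <= b], as a larger [z] is fixed by [h] and [g].
     Hence [h z <= h b < b]. *)
  exists h => // g gm F _ Fsub; exists (g b); split.
  + by exists b.
  + exact: rigid_top_embedding.
  + move=> y /Fsub[z _ <-] /= ghzL; rewrite gm; apply: le_lt_trans hbb.
    rewrite leNgt hm; apply/negP => bz.
    have zR : rigid_top z by apply: contrapT => /bmax; rewrite leNgt bz.
    by apply: ghzL; rewrite (zR.2 h) ?(zR.2 g).
(* Without a maximum outside [rigid_top], no shrinking is required: [w] is the image of a point
   above the preimage of the largest such element of [F]. *)
- exists id => // g gm F finF Fsub.
  have [F0|/set0P FL0] := eqVneq (F `&` ~` rigid_top) set0.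
    exists (g x0); split; [by exists x0|exact: rigid_top_embedding|].
    move=> y Fy yL; suff : (F `&` ~` rigid_top) y by rewrite F0.
    by split.
  have [|c [Fc cL] cmax] := finite_set_max _ FL0.
    by apply: sub_finite_set finF => y [].
  have [z _ gz] := Fsub _ Fc; rewrite /= in gz.
  have zL : ~ rigid_top z.
    move=> zR; apply: cL; by rewrite -gz (zR.2 g).
  have [z' z'L zz'] : exists2 z', ~ rigid_top z' & z < z'.
    apply: contrapT => noz; apply: nomax; exists z; split=> // y yL.
    by rewrite leNgt; apply/negP => zy; apply: noz; exists y.
  exists (g z'); split; [by exists z'|exact: rigid_top_embedding|].
  move=> y Fy yL; apply: (@le_lt_trans _ _ c); first by apply: cmax; split.
  by rewrite -gz gm.
Qed.

(** The cut [p] is the largest successor of an index satisfying [P]: it is 0 if there is none and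
    [m] if all do, hence the type ['I_m.+1]. *)
Lemma ord_prefix m (P : pred 'I_m) :
  (forall i j : 'I_m, (i <= j)%N -> P j -> P i) ->
  exists p : 'I_m.+1, forall j : 'I_m, P j = (j < p)%N.
Proof.
move=> Pdown.
have lt_max : (\max_(j | P j) j.+1 < m.+1)%N.
  by rewrite ltnS; apply/bigmax_leqP => j _.
exists (Ordinal lt_max) => j /=; apply/idP/idP => [Pj|].
  exact: (leq_bigmax_cond (F := fun j : 'I_m => j.+1) j Pj).
apply: contraTT => nPj; rewrite -leqNgt; apply/bigmax_leqP => i Pi.
by rewrite ltnNge; apply: contra nPj => ji; apply: Pdown Pi.
Qed.

Lemma lift_mono n (p : 'I_n.+1) : {mono lift p : i j / i < j}.
Proof.
by apply: leW_mono => i j; rewrite !leEord /= leq_bump2.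
Qed.

Definition Emb_del m (f : Emb A m.+1) (p : 'I_m.+1) : Emb A m :=
  exist (fun f : 'I_m -> A => {mono f : i j / i < j}) (sval f \o lift p)
    (fun i j => etrans (svalP f (lift p i) (lift p j)) (lift_mono p i j)).

Lemma Emb_insert m (f : Emb A m) w : (forall i, sval f i != w) ->
  exists (f' : Emb A m.+1) p, sval f' p = w /\ Emb_del f' p = f.
Proof.
case: f => f fm /= fw.
(* The insertion position [p] is the number of entries below [w]. *)
have [p pP] : exists p : 'I_m.+1, forall j, (f j < w) = (j < p)%N.
  apply: ord_prefix => i j ij; apply: le_lt_trans.
  by rewrite leNgt fm -leNgt.
have lift_ltp i : (lift p i < p)%N = (i < p)%N.
  by rewrite /= /bump; case: (leqP p i) => pi; rewrite // ltnNge ltnW.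
pose F i := if unlift p i is Some j then f j else w.
have Fm : {mono F : i j / i < j}.
  apply: leW_mono; apply: le_mono => i j; rewrite /F.
  case: unliftP => [i' ->|->]; case: unliftP => [j' ->|->].
  - by rewrite lift_mono fm.
  - by rewrite ltEord lift_ltp pP.
  - rewrite lt_neqAle [w == _]eq_sym fw /= leNgt pP -lift_ltp -leqNgt.
    exact: ltnW.
  - by rewrite ltxx.
exists (exist _ F Fm), p; split; first by rewrite /= /F unlift_none.
by apply: eq_exist; apply: funext => i; rewrite /= /F liftK.
Qed.

(* [ord0] is a junk value, taken only when no entry of [f] is outside [rigid_top]. *)
Definition last_flexible m (f : Emb A m.+1) : 'I_m.+1 :=
  xget ord0 [set i | ~ rigid_top (sval f i) /\
    forall j, ~ rigid_top (sval f j) -> j <= i].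

Lemma ramsey_bound_pred m t : infinite_set [set: A] ->
  ramsey_bound A m.+1 t -> ramsey_bound A m t.
Proof.
move=> infA [t1 bt]; split=> // k chi k2.
have [h hm hP] := copy_extension infA.
have [U [g gm gbij] le_t] :=
  bt k (fun f => chi (Emb_del f (last_flexible f))) k2.
exists (range (g \o h)).
  by apply: isomorphic_copy_range => x y /=; rewrite gm hm.
apply: card_le_trans le_t; apply: subset_card_le => _ [f fU <-].
have [||w [wU wL wmax]] := hP g gm (range (sval f)).
- exact: finite_image.
- by move=> _ [i _ <-]; apply: fU.
have [|f' [p [f'p f'K]]] := @Emb_insert _ f w.
  move=> i; apply/eqP => fiw; have := wmax _ (ex_intro2 _ _ i I erefl).
  by rewrite fiw ltxx => /(_ wL).
have f'lift i : sval f' (lift p i) = sval f i by rewrite -f'K.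
(* All other entries of [f'] outside [rigid_top] are below [w], so the deletion in the pulled-back
   coloring removes exactly [w] and gives back [f]. *)
have lastp : last_flexible f' = p.
  have pP : ~ rigid_top (sval f' p) /\
      forall j, ~ rigid_top (sval f' j) -> j <= p.
    rewrite f'p; split=> // j; case: (unliftP p j) => [i ->|-> //].
    rewrite f'lift => /(wmax _ (ex_intro2 _ _ i I erefl)).
    by rewrite -f'p -f'lift (svalP f') => /ltW.
  apply: xget_unique => // q [qL qmax]; apply/le_anti.
  by rewrite pP.2 // qmax //; apply: pP.1.
exists f' => [i|]; last by rewrite lastp f'K.
apply: (set_bij_sub gbij).
case: (unliftP p i) => [j ->|->]; last by rewrite f'p.
by rewrite f'lift; have [x _ <-] := fU j; exists (h x).
Qed.

End Chain.

Theorem theorem3p7 (d : Order.disp_t) (A : orderType d)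
    (A_countable : countable [set: A]%classic)
    (A_infinite : infinite_set [set: A]%classic)
    (m n : nat) (m_ge1 : (1 <= m)%N) (n_ge1 : (1 <= n)%N) :
  (m <= n)%N -> (T A m <= T A n)%E.
Proof.
move=> mn.
have bound t : ramsey_bound A n t -> ramsey_bound A m t.
  elim: n mn {n_ge1} => [|n IHn]; first by rewrite leqn0 => /eqP ->.
  rewrite leq_eqVlt => /orP[/eqP -> //|mn] /(ramsey_bound_pred A_infinite).
  exact: IHn.
(* The least bound for [n] is also a bound for [m]; if [m] has no bound, neither has [n]. *)
rewrite /T; case: pselect => [exm|nexm]; case: pselect => [exn|nexn] //.
- rewrite lee_fin lez_nat; case: ex_minnP => a _ amin.
  by case: ex_minnP => b /asboolP/bound/asboolP/amin.
- by case: nexm; case: exn => t /asboolP/bound/asboolP; exists t.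
Qed.
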